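(* Let $n$ be a positive integer whose Collatz sequence has a maximum, let $p$ be the peak value of the Collatz sequence starting at $n$, and let $u$ be the odd number immediately before $p$ in this sequence (assuming such a term occurs). Then $u\equiv 1\pmod 4$, i.e. $u=4l+1$ for some nonnegative integer $l$.
   Context: The Collatz map $T$ on the positive integers is $T(m)=m/2$ if $m$ is even and $T(m)=3m+1$ if $m$ is odd; $T^i$ denotes its $i$-fold iterate. The Collatz sequence starting at $n$ is the infinite sequence $n, T(n), T^2(n),\dots$. Its peak value is the maximum of all its terms. That $u$ is the odd number immediately before $p$ means that $u$ is odd and, for some $i\ge 0$, $T^i(n)=u$ and $T^{i+1}(n)=T(u)=p$. *)

(* Defs.v *)
From mathcomp Require Import all_boot.
Set Implicit Arguments.
Unset Strict Implicit.
Unset Printing Implicit Defensive.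

(* Total on nat; only its values on positive integers are meant, and it maps
   positive integers to positive integers. *)
Definition collatz (m : nat) : nat := if odd m then 3 * m + 1 else m %/ 2.

Definition collatz_seq (n i : nat) : nat := iter i collatz n.

(* The maximum, not merely an upper bound, so no such p exists when the
   sequence is unbounded. *)
Definition is_peak_value (n p : nat) : Prop :=
  (exists i : nat, collatz_seq n i = p) /\
  (forall j : nat, collatz_seq n j <= p).

Definition odd_immediately_before (n p u : nat) : Prop :=
  odd u /\ exists i : nat, collatz_seq n i = u /\ collatz_seq n i.+1 = p.

(* Main.v *)
Require Import Defs.
From mathcomp Require Import all_boot.
From mathcomp Require Import zify.

(** An odd [u] that is not [1] modulo [4] has the form [4k + 3].  Then
    [3u + 1 = 12k + 10] is only divisible by [2] once, its half [6k + 5] is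
    odd again, and the next term is [18k + 16], which exceeds [12k + 10].  So
    the successor of such a [u] is overtaken two steps later and cannot be a
    peak value. *)

Lemma collatz_odd m : odd m -> collatz m = 3 * m + 1.
Proof. by rewrite /collatz => ->. Qed.

Lemma collatz_double m : collatz (2 * m) = m.
Proof. by rewrite /collatz oddM mulKn. Qed.

Lemma iter3_collatz_3mod4 k : iter 3 collatz (4 * k + 3) = 18 * k + 16.
Proof.
rewrite /= (collatz_odd (4 * k + 3)); last by lia.
have -> : 3 * (4 * k + 3) + 1 = 2 * (6 * k + 5) by lia.
rewrite collatz_double collatz_odd; lia.
Qed.

Theorem theorem2p11 (n p u : nat) (n_gt0 : 0 < n)
    (p_peak : is_peak_value n p) (u_before : odd_immediately_before n p u) :
  u = 1 %[mod 4] /\ exists l : nat, u = 4 * l + 1.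
Proof.
case: p_peak => _ p_max; case: u_before => u_odd [i [iu ip]].
have p_eq : p = 3 * u + 1.
  by rewrite -ip /collatz_seq iterS -/(collatz_seq n i) iu collatz_odd.
have u_mod4 : u %% 4 = 1.
  have [//|u3] : u %% 4 = 1 \/ u %% 4 = 3 by lia.
  have u_eq : u = 4 * (u %/ 4) + 3 by lia.
  have := p_max (3 + i).
  rewrite /collatz_seq iterD -/(collatz_seq n i) iu {1}u_eq.
  rewrite iter3_collatz_3mod4; lia.
by split=> //; exists (u %/ 4); lia.
Qed.
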